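(* Let $n,d,r$ be positive integers with $r>1$. For each noncrossing set partition $\gamma\in\mathcal{NC}(n,d,r)$, choose an ordering of its blocks, giving an ordered set partition $\pi_\gamma\in\mathcal{OP}(n,d,r)$. Then the family $\{[\pi_\gamma]_r:\gamma\in\mathcal{NC}(n,d,r)\}$ is linearly independent in $\mathbb{C}[M]$.
   Context: An (unordered) set partition of $[n]$ is a set of nonempty pairwise disjoint subsets (blocks) with union $[n]$; it is noncrossing if there are no $a<b<c<e$ in $[n]$ with $a,c$ in one block and $b,e$ in a different block. $\mathcal{NC}(n,d,r)$ is the set of noncrossing set partitions of $[n]$ with $d$ blocks, each of size at least $r$. An ordered set partition with $d$ blocks is a sequence $\pi=(\pi_1\mid\cdots\mid\pi_d)$ of such blocks; $\mathcal{OP}(n,d,r)$ is the set of those with every block of size at least $r$. Let $M=(x_{ij})_{1\le i,j\le n}$ be an $n\times n$ matrix of distinct indeterminates; $M_I^J$ is the determinant of the submatrix with rows $I$ and columns $J$ (both increasing). For $\pi\in\mathcal{OP}(n,d,r)$, an $r$-jellyfish tableau for $\pi$ is an array $T$ with $n-(d-1)r$ rows and $d$ columns, cells empty or containing elements of $[n]$, such that all cells in rows $1,\dots,r$ are nonempty, each row $i>r$ has exactly one nonempty cell, and the nonempty entries of column $j$ are exactly $\pi_j$, increasing downward; $\mathcal{J}_r(\pi)$ is their set. $\mathrm{sgn}(T)=(-1)^{\mathrm{inv}(T)}$, $\mathrm{inv}(T)$ being the number of inversions of the row reading word (rows left to right, top to bottom, empty cells skipped). $\mathrm{J}(T)=\prod_jM^{\pi_j}_{R_j(T)}$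 with $R_j(T)$ the set of rows in which column $j$ is nonempty, and $[\pi]_r=\sum_{T\in\mathcal{J}_r(\pi)}\mathrm{sgn}(T)\mathrm{J}(T)$. *)

(* Defs.v *)
From HB Require Import structures.
From mathcomp Require Import all_boot all_order all_algebra.
From mathcomp Require Import mpoly.

Set Implicit Arguments.
Unset Strict Implicit.
Unset Printing Implicit Defensive.

Import GRing.Theory.
Local Open Scope ring_scope.

(* The set [n] = {1, ..., n} is represented by 'I_n = {0, ..., n-1}, and rows
   and columns of arrays are likewise numbered from 0. *)

Definition noncrossing (n : nat) (P : {set {set 'I_n}}) : bool :=
  [forall A in P, forall B in P, (A != B) ==>
    [forall a : 'I_n, forall b : 'I_n, forall c : 'I_n, forall e : 'I_n,
      ~~ [&& (a < b)%N, (b < c)%N, (c < e)%N,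
             a \in A, c \in A, b \in B & e \in B]]].

Definition NC (n d r : nat) : {set {set {set 'I_n}}} :=
  [set P | [&& partition P [set: 'I_n], #|P| == d,
               [forall B in P, (r <= #|B|)%N] & noncrossing P]].

Definition OP (n d r : nat) : {set d.-tuple {set 'I_n}} :=
  [set p : d.-tuple {set 'I_n} |
    [&& uniq p, partition [set:: p] [set: 'I_n] &
        all (fun B : {set 'I_n} => r <= #|B|)%N p]].

(* Truncated subtraction is harmless: n >= d * r whenever OP n d r is
   nonempty. *)
Definition nrows (n d r : nat) : nat := (n - d.-1 * r)%N.

(* A cell is empty when it contains None. *)
Definition tableau (n d r : nat) := 'M[option 'I_n]_(nrows n d r, d).

Definition jellyfish (n d r : nat) (p : d.-tuple {set 'I_n}) :
    {set tableau n d r} :=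
  [set T : tableau n d r |
    [&& [forall i : 'I_(nrows n d r), forall j, (i < r)%N ==> (T i j != None)],
        [forall i : 'I_(nrows n d r),
           (r <= i)%N ==> (#|[set j | T i j != None]| == 1)%N],
        [forall j, [set x | [exists i, T i j == Some x]] == tnth p j] &
        [forall j, forall i : 'I_(nrows n d r), forall k : 'I_(nrows n d r),
           forall x : 'I_n, forall y : 'I_n,
           [&& (i < k)%N, T i j == Some x & T k j == Some y] ==> (x < y)%N]]].

Definition reading_word (n d r : nat) (T : tableau n d r) : seq 'I_n :=
  pmap id [seq T i j | i <- enum 'I_(nrows n d r), j <- enum 'I_d].

Definition inversions (n : nat) (w : seq 'I_n) : nat :=
  #|[set kl : 'I_(size w) * 'I_(size w) |
      (kl.1 < kl.2)%N &&
      (tnth (in_tuple w) kl.2 < tnth (in_tuple w) kl.1)%N]|.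

Definition inv (n d r : nat) (T : tableau n d r) : nat :=
  inversions (reading_word T).

(* The determinant of the submatrix with rows I and columns J; enum_val lists
   the elements of a set of ordinals increasingly.  The value 0 for
   #|I| <> #|J| is a dummy. *)
Definition set_minor (K : comNzRingType) (n : nat) (M : 'M[K]_n)
    (I J : {set 'I_n}) : K :=
  match #|I| =P #|J| with
  | ReflectT eqIJ =>
      \det (\matrix_(a < #|I|, b < #|I|)
              M (enum_val a) (enum_val (cast_ord eqIJ b)))
  | ReflectF _ => 0
  end.

(* The variable x_ij is the one of index mxvec_index i j; this map is a
   bijection from 'I_n * 'I_n to 'I_(n * n). *)
Definition indet_mx (K : comNzRingType) (n : nat) : 'M[{mpoly K[n * n]}]_n :=
  \matrix_(i, j) 'X_(mxvec_index i j).

Definition col_rows (n d r : nat) (T : tableau n d r) (j : 'I_d) :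
    {set 'I_n} :=
  [set widen_ord (leq_subr (d.-1 * r) n) i | i in [set i | T i j != None]].

Definition jelly_prod (K : comNzRingType) (n d r : nat)
    (p : d.-tuple {set 'I_n}) (T : tableau n d r) : {mpoly K[n * n]} :=
  \prod_(j < d) set_minor (indet_mx K n) (col_rows T j) (tnth p j).

Definition jelly_inv (K : comNzRingType) (n d r : nat)
    (p : d.-tuple {set 'I_n}) : {mpoly K[n * n]} :=
  \sum_(T in jellyfish r p) (-1) ^+ inv T * jelly_prod K p T.

(* Linear independence of the family (v i), i in A. *)
Definition lin_indep (K : pzRingType) (V : lmodType K) (I : finType)
    (A : {set I}) (v : I -> V) : Prop :=
  forall c : I -> K,
    \sum_(i in A) c i *: v i = 0 -> forall i, i \in A -> c i = 0.

(* Main.v *)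
(** Let the 0/1 matrix of a map f from columns to rows have a single 1 in each
column c, in row f c.  At this matrix a minor with rows I and columns J
vanishes unless f maps J onto I, so [pi] vanishes unless f reaches each of the
first r rows on every block of pi; and it is +1 or -1 if moreover f is injective
on blocks and reaches every other row exactly once.  Given a noncrossing P, let
f send the maximum of each block to row 0, its minimum to row 1 (this needs
r > 1), and the other elements to the remaining rows.  If [Q] is nonzero at
this matrix, each block of Q contains a block maximum and a block minimum of P,
so the sum of max - min over the blocks of Q is at least the one for P; in case
of equality Q has the same minima and maxima as P, which forces Q = P.  The
matrix of the values of the [Q] at these points is therefore triangular with
nonzero diagonal. *)

Require Import Defs.
From mathcomp Require Import all_boot all_order all_algebra.
From mathcomp Require Import reals.
From mathcomp Require Import complex.
From mathcomp Require Import mpoly.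
From mathcomp Require Import perm zify.

Set Implicit Arguments.
Unset Strict Implicit.
Unset Printing Implicit Defensive.

Import GRing.Theory.

(** * Minima and maxima of blocks *)

Lemma sorted_enum_set (n : nat) (B : {set 'I_n}) :
  sorted (relpre val ltn) (enum B).
Proof.
rewrite /enum_mem; apply: sorted_filter.
  by move=> y x z; apply: ltn_trans.
by rewrite -enumT -sorted_map val_enum_ord iota_ltn_sorted.
Qed.

Lemma relpre_ltn_trans (n : nat) :
  transitive (relpre (val : 'I_n -> nat) ltn).
Proof. by move=> y x z; apply: ltn_trans. Qed.

(* Both are the dummy x0 on the empty set. *)
Definition bmin (n : nat) (x0 : 'I_n) (B : {set 'I_n}) := head x0 (enum B).
Definition bmax (n : nat) (x0 : 'I_n) (B : {set 'I_n}) := last x0 (enum B).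

Lemma bmin_mem (n : nat) (x0 x : 'I_n) (B : {set 'I_n}) :
  x \in B -> bmin x0 B \in B.
Proof.
rewrite /bmin -!(mem_enum B); case: (enum B) => //= y s _.
by rewrite mem_head.
Qed.

Lemma bmax_mem (n : nat) (x0 x : 'I_n) (B : {set 'I_n}) :
  x \in B -> bmax x0 B \in B.
Proof.
rewrite /bmax -!(mem_enum B); case: (enum B) => //= y s _.
by rewrite mem_last.
Qed.

Lemma bmin_le (n : nat) (x0 x : 'I_n) (B : {set 'I_n}) :
  x \in B -> bmin x0 B <= x.
Proof.
rewrite /bmin -(mem_enum B); have := sorted_enum_set B.
case: (enum B) => //= y s; rewrite (path_sortedE (@relpre_ltn_trans n)).
move=> /andP[/allP ys _]; rewrite inE => /predU1P[->//|/ys /=].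
exact: ltnW.
Qed.

Lemma bmax_ge (n : nat) (x0 x : 'I_n) (B : {set 'I_n}) :
  x \in B -> x <= bmax x0 B.
Proof.
rewrite /bmax -(mem_enum B); have := sorted_enum_set B.
case/lastP: (enum B) => // s y.
rewrite last_rcons mem_rcons inE => srt /predU1P[->//|xs].
have := srt; rewrite -cats1 (sorted_pairwise (@relpre_ltn_trans n)).
rewrite pairwise_cat => /and3P[/allrelP /(_ x y xs)].
by rewrite mem_head => /(_ isT) /ltnW.
Qed.

(** * Noncrossing partitions and the bounds of their blocks *)

Lemma partition_block_eq (T : finType) (D : {set T}) (P : {set {set T}})
    (x : T) (A B : {set T}) :
  partition P D -> A \in P -> B \in P -> x \in A -> x \in B -> A = B.
Proof.
case/and3P=> _ tI _ AP BP xA xB.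
by rewrite -(def_pblock tI AP xA) -(def_pblock tI BP xB).
Qed.

Lemma noncrossingP (n : nat) (P : {set {set 'I_n}}) (A B : {set 'I_n})
    (a b c e : 'I_n) :
  noncrossing P -> A \in P -> B \in P -> a < b -> b < c -> c < e ->
  a \in A -> c \in A -> b \in B -> e \in B -> A = B.
Proof.
move=> /forall_inP/(_ A) + AP BP ab bc ce aA cA bB eB.
move=> /(_ AP) /forall_inP /(_ B BP) /implyP H.
case: (eqVneq A B) => // /H /forallP/(_ a) /forallP/(_ b) /forallP/(_ c).
by move=> /forallP/(_ e); rewrite ab bc ce aA cA bB eB.
Qed.

(** If [D] began before [B], then [bmin D < bmin B < w < bmax B] would be a crossing; if it ended
    after [B], then [bmin B < w < bmax B < bmax D] would be one. *)
Lemma noncrossing_nested (n : nat) (x0 w : 'I_n) (P : {set {set 'I_n}})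
    (B D : {set 'I_n}) :
  partition P [set: 'I_n] -> noncrossing P -> B \in P -> D \in P -> B != D ->
  w \in D -> bmin x0 B < w -> w < bmax x0 B ->
  (bmin x0 B < bmin x0 D) && (bmax x0 D < bmax x0 B).
Proof.
move=> parP ncP BP DP neqBD wD lw wu.
have [b bB] : exists b, b \in B.
  by apply/set0Pn; case/and3P: parP => _ _; apply: contraNneq => <-.
have mBB := bmin_mem x0 bB; have MBB := bmax_mem x0 bB.
have mDD := bmin_mem x0 wD; have MDD := bmax_mem x0 wD.
have neq x y : x \in B -> y \in D -> x != y :> nat.
  move=> xB yD; apply: contraNneq neqBD => /val_inj xy.
  by rewrite -xy in yD; rewrite (partition_block_eq parP BP DP xB yD).
rewrite !ltn_neqAle neq // [bmax x0 D == _ :> nat]eq_sym neq //=.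
rewrite leqNgt [X in _ && X]leqNgt; apply/andP.
split; apply: contraNN neqBD => lt; apply/eqP.
  by apply/esym; apply: (noncrossingP ncP DP BP lt lw wu).
by apply: (noncrossingP ncP BP DP lw wu lt).
Qed.

(* Openers and closers determine a noncrossing partition, as they do for a
   parenthesization: by induction on the length of the interval it spans, each
   block of P is a block of Q. *)
Lemma noncrossing_bounds_sub (n : nat) (x0 : 'I_n) (P Q : {set {set 'I_n}}) :
  partition P [set: 'I_n] -> partition Q [set: 'I_n] ->
  noncrossing P -> noncrossing Q ->
  bmin x0 @: Q = bmin x0 @: P -> bmax x0 @: Q = bmax x0 @: P ->
  P \subset Q.
Proof.
move=> parP parQ ncP ncQ eqm eqM; apply/subsetP => B.
have [k] := ubnP (bmax x0 B - bmin x0 B); elim: k B => // k IH B ltk BP.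
have pick_block R x : partition R [set: 'I_n] ->
    exists2 C : {set 'I_n}, C \in R & x \in C.
  move=> /cover_partition/setP/(_ x); rewrite inE => /bigcupP[C CR xC].
  by exists C.
have pick_elt R C : partition R [set: 'I_n] -> C \in R -> exists c, c \in C.
  move=> /and3P[_ _ R0] CR; apply/set0Pn.
  by apply: contraNneq R0 => <-.
have [b bB] := pick_elt _ _ parP BP.
have mBB := bmin_mem x0 bB; have MBB := bmax_mem x0 bB.
(* Any other block of [P] that meets the open interval spanned by [B] is nested in it, so the
   induction hypothesis puts it in [Q]. *)
have inner D w : D \in P -> B != D -> w \in D ->
    bmin x0 B < w -> w < bmax x0 B -> D \in Q.
  move=> DP BD wD lw wu.
  have /andP[lm lM] := noncrossing_nested parP ncP BP DP BD wD lw wu.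
  apply: IH => //; have := bmin_le x0 wD; have := bmax_ge x0 wD; lia.
have ofmin y C : C \in Q -> y = bmin x0 C ->
    exists2 D, D \in P & bmin x0 D = y.
  move=> CQ ->; have : bmin x0 C \in bmin x0 @: P by rewrite -eqm imset_f.
  by case/imsetP=> D DP ->; exists D.
have ofmax y C : C \in Q -> y = bmax x0 C ->
    exists2 D, D \in P & bmax x0 D = y.
  move=> CQ ->; have : bmax x0 C \in bmax x0 @: P by rewrite -eqM imset_f.
  by case/imsetP=> D DP ->; exists D.
have minmem R C : partition R [set: 'I_n] -> C \in R -> bmin x0 C \in C.
  by move=> pR /(pick_elt _ _ pR)[c]; apply: bmin_mem.
have maxmem R C : partition R [set: 'I_n] -> C \in R -> bmax x0 C \in C.
  by move=> pR /(pick_elt _ _ pR)[c]; apply: bmax_mem.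
have innerE C D w v : C \in Q -> D \in P -> B != D -> w \in D ->
    bmin x0 B < w -> w < bmax x0 B -> v \in C -> v \in D -> C = D.
  move=> CQ DP BD wD lw wu vC vD.
  exact: (partition_block_eq parQ CQ (inner _ _ DP BD wD lw wu) vC vD).
have disj D v : D \in P -> B != D -> v \in B -> v \in D -> False.
  move=> DP BD vB vD.
  by rewrite (partition_block_eq parP BP DP vB vD) eqxx in BD.
(* [C], the block of [Q] that opens where [B] does, will turn out to be [B]. *)
have : bmin x0 B \in bmin x0 @: Q by rewrite eqm imset_f.
case/imsetP => C CQ mBC.
have mBinC : bmin x0 B \in C by rewrite mBC (minmem _ _ parQ).
have neqB_min D : bmin x0 D != bmin x0 B -> B != D.
  by apply: contraNneq => ->.
have neqB_max D : bmax x0 D != bmax x0 B -> B != D.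
  by apply: contraNneq => ->.
(* If [C] closed before [B], a block [D] of [P] other than [B] would close at the same point, inside
   [B]. Then [D = C] by [innerE], and [D] would contain the minimum of [B]. *)
have MCge : bmax x0 B <= bmax x0 C.
  rewrite leqNgt; apply/negP => ltM.
  have [D DP MD] := ofmax _ _ CQ erefl.
  have BD : B != D by apply: neqB_max; rewrite MD neq_ltn ltM.
  have lw : bmin x0 B < bmax x0 C.
    rewrite ltn_neqAle bmax_ge // andbT; apply/eqP => /val_inj e.
    by apply: (disj D (bmin x0 B)); rewrite // e -MD (maxmem _ _ parP).
  have MCD : bmax x0 C \in D by rewrite -MD (maxmem _ _ parP).
  have CD := innerE _ _ _ _ CQ DP BD MCD lw ltM (maxmem _ _ parQ CQ) MCD.
  by apply: (disj D (bmin x0 B)); rewrite // -CD.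
(* Otherwise the block [C2] of [Q] closing at [bmax B] is nested in [C]. Its minimum opens a block
   [D] of [P] inside [B], so [D = C2] meets [B] in [bmax B]. *)
have MCE : bmax x0 C = bmax x0 B.
  have : bmax x0 B \in bmax x0 @: Q by rewrite eqM imset_f.
  case/imsetP => C2 C2Q MBC2.
  have MBC2in : bmax x0 B \in C2 by rewrite MBC2 (maxmem _ _ parQ).
  case: (eqVneq C C2) => [->//|CC2].
  have lt0 : bmin x0 B < bmax x0 B.
    rewrite ltn_neqAle bmin_le // andbT; apply: contraNneq CC2 => /val_inj e.
    by rewrite (partition_block_eq parQ CQ C2Q mBinC) // e.
  have lt1 : bmax x0 B < bmax x0 C.
    rewrite ltn_neqAle MCge andbT; apply: contraNneq CC2 => /val_inj e.
    by rewrite (partition_block_eq parQ CQ C2Q _ MBC2in) // e (maxmem _ _ parQ).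
  have /andP[lm _] : (bmin x0 C < bmin x0 C2) && (bmax x0 C2 < bmax x0 C).
    by apply: (noncrossing_nested parQ ncQ CQ C2Q CC2 MBC2in); rewrite -?mBC.
  rewrite -mBC in lm.
  have [D DP mD] := ofmin _ _ C2Q erefl.
  have BD : B != D by apply: neqB_min; rewrite mD neq_ltn lm orbT.
  have ltu : bmin x0 C2 < bmax x0 B.
    rewrite ltn_neqAle bmin_le // andbT; apply/eqP => /val_inj e.
    by apply: (disj D (bmax x0 B)); rewrite // -e -mD (minmem _ _ parP).
  have mDin : bmin x0 C2 \in D by rewrite -mD (minmem _ _ parP).
  have C2D := innerE _ _ _ _ C2Q DP BD mDin lm ltu (minmem _ _ parQ C2Q) mDin.
  by case: (disj D (bmax x0 B)) => //; rewrite -C2D.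
have BC : B = C; last by rewrite BC.
have MBinC : bmax x0 B \in C by rewrite -MCE (maxmem _ _ parQ).
apply/setP => x; apply/idP/idP => [xB|xC].
  case: (eqVneq x (bmin x0 B)) => [->//|xm].
  case: (eqVneq x (bmax x0 B)) => [->//|xM].
  have lx : bmin x0 B < x by rewrite ltn_neqAle bmin_le // andbT eq_sym.
  have xu : x < bmax x0 B by rewrite ltn_neqAle bmax_ge // andbT.
  (* The same argument: if [C3] differs from [C], it is nested in [C], and the block of [P] with the
     same minimum equals [C3], yet contains [x], an element of [B]. *)
  have [C3 C3Q xC3] := pick_block _ x parQ.
  case: (eqVneq C C3) => [->//|CC3].
  have /andP[lm _] : (bmin x0 C < bmin x0 C3) && (bmax x0 C3 < bmax x0 C).
    apply: (noncrossing_nested parQ ncQ CQ C3Q CC3 xC3); first by rewrite -mBC.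
    by rewrite MCE.
  rewrite -mBC in lm.
  have [D DP mD] := ofmin _ _ C3Q erefl.
  have BD : B != D by apply: neqB_min; rewrite mD neq_ltn lm orbT.
  have ltu : bmin x0 C3 < bmax x0 B by apply: leq_ltn_trans xu; apply: bmin_le.
  have mDin : bmin x0 C3 \in D by rewrite -mD (minmem _ _ parP).
  have C3D := innerE _ _ _ _ C3Q DP BD mDin lm ltu (minmem _ _ parQ C3Q) mDin.
  by case: (disj D x) => //; rewrite -C3D.
(* Conversely, if [D] differs from [B], it lies inside [B], hence in [Q], and equals [C], which
   contains the minimum of [B]. *)
have [D DP xD] := pick_block _ x parP.
case: (eqVneq B D) => [->//|BD].
have lx : bmin x0 B < x.
  rewrite ltn_neqAle {2}mBC bmin_le // andbT.
  by apply/eqP => /val_inj e; apply: (disj D (bmin x0 B)); rewrite // e.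
have xu : x < bmax x0 B.
  rewrite ltn_neqAle -{2}MCE bmax_ge // andbT.
  by apply/eqP => /val_inj e; apply: (disj D (bmax x0 B)); rewrite // -e.
have CD := innerE _ _ _ _ CQ DP BD xD lx xu xC xD.
by case: (disj D (bmin x0 B)) => //; rewrite -CD.
Qed.

Lemma noncrossing_bounds_inj (n : nat) (x0 : 'I_n) (P Q : {set {set 'I_n}}) :
  partition P [set: 'I_n] -> partition Q [set: 'I_n] ->
  noncrossing P -> noncrossing Q ->
  bmin x0 @: Q = bmin x0 @: P -> bmax x0 @: Q = bmax x0 @: P ->
  P = Q.
Proof.
move=> parP parQ ncP ncQ eqm eqM; apply/eqP; rewrite eqEsubset.
by rewrite !(@noncrossing_bounds_sub _ x0).
Qed.

(** * Extremality of the total spread of the blocks *)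

(** Disjointness of blocks makes [p] injective on [Q], so its image has [#|P|] elements and fills
    [g @: P]. Hence [g] is injective on [P], and both sums run over the same set. It is used with
    [bmin] and [bmax] as [g]. *)
Lemma transversal_reindex (T : finType) (P Q : {set {set T}})
    (g p : {set T} -> T) :
  trivIset Q -> #|Q| = #|P| ->
  {in Q, forall B, (p B \in B) && (p B \in g @: P)} ->
  p @: Q = g @: P /\
  forall F : T -> nat, \sum_(B in Q) F (p B) = \sum_(B in P) F (g B).
Proof.
move=> tI cQP pP.
have p_inj : {in Q &, injective p}.
  move=> A B AQ BQ e; have /andP[pA _] := pP _ AQ; have /andP[pB _] := pP _ BQ.
  by rewrite -(def_pblock tI AQ pA) e (def_pblock tI BQ pB).
have sub : p @: Q \subset g @: P.
  by apply/subsetP => _ /imsetP[B BQ ->]; case/andP: (pP _ BQ).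
have cp : #|p @: Q| = #|P| by rewrite card_in_imset.
have pg : p @: Q = g @: P.
  by apply/eqP; rewrite eqEcard sub cp leq_imset_card.
have g_inj : {in P &, injective g} by apply/imset_injP; rewrite -pg cp.
split=> // F.
by rewrite -(big_imset F p_inj) -(big_imset F g_inj) /= pg.
Qed.

(** The sum of max - min over the blocks, shifted by [n] per block so that no subtraction truncates.
    The shift is the same for partitions with equally many blocks. *)
Definition spread (n : nat) (x0 : 'I_n) (P : {set {set 'I_n}}) :=
  \sum_(B in P) (bmax x0 B + (n - bmin x0 B)).

(** Choose in each block [B] of [Q] a minimum [p B] and a maximum [q B] of blocks of [P]. The
    differences [q B - p B] add up to the spread of [P], and each is at most max - min of [B]. So
    all these bounds are equalities, and [Q] has the minima and maxima of [P]. *)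
Lemma spread_min (n : nat) (x0 : 'I_n) (P Q : {set {set 'I_n}}) :
  partition P [set: 'I_n] -> partition Q [set: 'I_n] ->
  noncrossing P -> noncrossing Q -> #|Q| = #|P| ->
  {in Q, forall B : {set 'I_n}, exists2 x, x \in B & x \in bmin x0 @: P} ->
  {in Q, forall B : {set 'I_n}, exists2 x, x \in B & x \in bmax x0 @: P} ->
  spread x0 Q <= spread x0 P -> Q = P.
Proof.
move=> parP parQ ncP ncQ cQP hitm hitM le_spread.
have transv (X : {set 'I_n}) :
    {in Q, forall B : {set 'I_n}, exists2 x, x \in B & x \in X} ->
    exists p : {set 'I_n} -> 'I_n,
      {in Q, forall B : {set 'I_n}, (p B \in B) && (p B \in X)}.
  move=> hit.
  exists (fun B : {set 'I_n} => odflt x0 [pick x in B | x \in X]).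
  move=> B /hit[x xB xX].
  by case: pickP => //= /(_ x); rewrite xB xX.
have tI : trivIset Q by case/and3P: parQ.
have [p pP] := transv _ hitm; have [q qP] := transv _ hitM.
have [imp sump] := transversal_reindex tI cQP pP.
have [imq sumq] := transversal_reindex tI cQP qP.
have le_block B : B \in Q ->
    q B + (n - p B) <= bmax x0 B + (n - bmin x0 B)
      ?= iff ((q B == bmax x0 B) && (p B == bmin x0 B)).
  move=> BQ; have /andP[/[dup] pB /(bmin_le x0) le1 _] := pP _ BQ.
  have /andP[/[dup] qB /(bmax_ge x0) le2 _] := qP _ BQ.
  rewrite -!val_eqE /=; split; have := ltn_ord (p B); lia.
have le_sum := leqif_sum le_block.
have spreadP : spread x0 P = \sum_(B in Q) (q B + (n - p B)).
  by rewrite /spread !big_split /= sumq (sump (fun x => n - x)).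
have := le_spread; rewrite spreadP (geq_leqif le_sum).
move=> /forall_inP eqQ.
apply/esym/(@noncrossing_bounds_inj _ x0) => //.
  by rewrite -imp; apply: eq_in_imset => B /eqQ /andP[_ /eqP].
by rewrite -imq; apply: eq_in_imset => B /eqQ /andP[/eqP].
Qed.

(** * Assigning rows to the elements of a partition *)

(** The conditions under which the sets [f @: B] can be the sets of nonempty cells of the columns of
    a jellyfish tableau. *)
Definition fits (n m r : nat) (P : {set {set 'I_n}}) (f : 'I_n -> 'I_m) :=
  [/\ forall B : {set 'I_n}, B \in P -> {in B &, injective f},
      forall B : {set 'I_n}, B \in P ->
        forall i : 'I_m, i < r -> exists2 c, c \in B & f c = i,
      forall i : 'I_m, r <= i -> exists c, f c = i &
      forall c c' : 'I_n, r <= f c -> f c = f c' -> c = c'].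

(* The maximum of a block has rank 0, its minimum rank 1. *)
Definition cyc_rank (n : nat) (P : {set {set 'I_n}}) (c : 'I_n) :=
  index c (rotr 1 (enum (pblock P c))).

Lemma head_rotr1 (T : Type) (x0 : T) (s : seq T) :
  nth x0 (rotr 1 s) 0 = last x0 s.
Proof. by case/lastP: s => // s x; rewrite rotr1_rcons last_rcons. Qed.

Lemma nth1_rotr1 (T : Type) (x0 : T) (s : seq T) :
  1 < size s -> nth x0 (rotr 1 s) 1 = head x0 s.
Proof. by case/lastP: s => // s x; rewrite rotr1_rcons; case: s. Qed.

(** Each block contributes exactly the first [r] entries of its rotated enumeration. *)
Lemma card_cyc_rank_lt (n r : nat) (P : {set {set 'I_n}}) :
  partition P [set: 'I_n] -> (forall B, B \in P -> r <= #|B|) ->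
  #|[set c | cyc_rank P c < r]| = #|P| * r.
Proof.
move=> parP big; have tI : trivIset P by case/and3P: parP.
rewrite -sum1_card; under eq_bigl => c do rewrite inE.
transitivity (\sum_(c in [set: 'I_n] | cyc_rank P c < r) 1).
  by apply: eq_bigl => c; rewrite inE.
rewrite (set_partition_big_cond _ parP) /= -sum_nat_const.
apply: eq_bigr => B BP; rewrite sum1_card.
have -> : #|[pred c | (c \in B) && (cyc_rank P c < r)]|
        = #|take r (rotr 1 (enum B))|.
  apply: eq_card => c; rewrite inE /cyc_rank.
  case: (boolP (c \in B)) => [cB|ncB] /=.
    by rewrite (def_pblock tI BP cB) in_take_leq // ?size_rotr -?cardE ?big //
               mem_rotr mem_enum.
  apply/esym/negbTE; apply: contra ncB => /mem_take.
  by rewrite mem_rotr mem_enum.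
have /card_uniqP -> : uniq (take r (rotr 1 (enum B))).
  by apply: take_uniq; rewrite rotr_uniq enum_uniq.
by rewrite size_takel // size_rotr -cardE big.
Qed.

(** An element of rank below [r] goes to the row numbered by its rank, so row 0 receives the maxima
    and row 1 the minima. The remaining elements are sent bijectively to the rows from [r] on. *)
Lemma adapted_filling (n d r : nat) (x0 : 'I_n) (P : {set {set 'I_n}}) :
  0 < d -> 1 < r -> P \in NC n d r ->
  exists f : 'I_n -> 'I_(nrows n d r),
    [/\ fits r P f,
        forall c, f c = 0 :> nat -> c \in bmax x0 @: P &
        forall c, f c = 1 :> nat -> c \in bmin x0 @: P].
Proof.
move=> d_gt0 r_gt1; rewrite inE => /and4P[parP /eqP cardP /forall_inP big _].
have [covP tI _] := and3P parP.
(* The elements of S are sent to the rows that only one column may use. *)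
pose S := [set c | r <= cyc_rank P c].
have cardS : #|S| + d * r = n.
  rewrite -cardP -(card_cyc_rank_lt parP big) -[RHS]card_ord -(cardsC S).
  by congr (_ + _); apply: eq_card => c; rewrite !inE -ltnNge.
have dr : d * r = r + d.-1 * r by rewrite -mulSn prednK.
pose row c := if cyc_rank P c < r then cyc_rank P c else r + index c (enum S).
have row_lt c : row c < nrows n d r.
  (* Since [n = #|S| + d * r], removing [d.-1 * r] leaves the first [r] rows and one row per element
     of [S]. *)
  have rows : nrows n d r = r + #|S|.
    by rewrite /nrows; lia.
  rewrite rows /row; case: (ltnP (cyc_rank P c) r) => [lt|ge].
    by rewrite ltn_addr.
  by rewrite ltn_add2l cardE index_mem mem_enum inE.
have pb c : pblock P c \in P
  by rewrite pblock_mem // (cover_partition parP) inE.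
have mpb c : c \in rotr 1 (enum (pblock P c)).
  by rewrite mem_rotr mem_enum mem_pblock (cover_partition parP) inE.
have cycK c : nth x0 (rotr 1 (enum (pblock P c))) (cyc_rank P c) = c.
  by rewrite nth_index.
have starK c : r <= cyc_rank P c -> nth x0 (enum S) (index c (enum S)) = c.
  by move=> ge; rewrite nth_index // mem_enum inE.
have row_small c : row c < r -> row c = cyc_rank P c.
  rewrite /row; case: (ltnP (cyc_rank P c) r) => // _.
  by rewrite ltnNge leq_addr.
exists (fun c => Ordinal (row_lt c)); split.
- split.
  + move=> B BP c c' cB c'B [] /=; rewrite /row.
    case: (ltnP (cyc_rank P c) r) => [lt|ge];
      case: (ltnP (cyc_rank P c') r) => [lt'|ge'].
    * move=> e; rewrite -(cycK c) -(cycK c') e.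
      by rewrite (def_pblock tI BP cB) (def_pblock tI BP c'B).
    * by move=> e; move: lt; rewrite e ltnNge leq_addr.
    * by move=> e; move: lt'; rewrite -e ltnNge leq_addr.
    * by move/addnI => e; rewrite -(starK c) // -(starK c') // e.
  + move=> B BP i lt; exists (nth x0 (rotr 1 (enum B)) i).
      rewrite -mem_enum -(mem_rotr 1) mem_nth // size_rotr -cardE.
      exact: leq_trans lt (big _ BP).
    apply: val_inj; rewrite /= /row.
    have szi : i < size (rotr 1 (enum B)).
      by rewrite size_rotr -cardE (leq_trans lt (big _ BP)).
    have cB : nth x0 (rotr 1 (enum B)) i \in B.
      by rewrite -mem_enum -(mem_rotr 1) mem_nth.
    rewrite /cyc_rank (def_pblock tI BP cB) index_uniq ?lt //.
    by rewrite rotr_uniq enum_uniq.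
  + move=> i ge; have lti : i - r < size (enum S).
      by rewrite -cardE; have := ltn_ord i; rewrite [X in _ < X]/nrows; lia.
    have iS : nth x0 (enum S) (i - r) \in S by rewrite -mem_enum mem_nth.
    exists (nth x0 (enum S) (i - r)); apply: val_inj; rewrite /= /row.
    move: (iS); rewrite inE ltnNge => ->.
    by rewrite index_uniq ?enum_uniq ?subnKC.
  + move=> c c' /= ge [] e; move: (ge) e; rewrite /row.
    case: (ltnP (cyc_rank P c) r) => [?|gc] gec; first by lia.
    case: (ltnP (cyc_rank P c') r) => [?|gc'] e; first by lia.
    by move/addnI: e => e; rewrite -(starK c) // -(starK c') // e.
- move=> c /= e; have k0 : cyc_rank P c = 0 by rewrite -row_small e; lia.
  by apply/imsetP; exists (pblock P c); rewrite ?pb // -[LHS]cycK k0 head_rotr1.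
- move=> c /= e; have k1 : cyc_rank P c = 1 by rewrite -row_small e.
  apply/imsetP; exists (pblock P c); rewrite ?pb // -[LHS]cycK k1 nth1_rotr1 //.
  by rewrite -cardE (leq_trans r_gt1) ?big.
Qed.

(** * Jellyfish tableaux and their nonempty cells *)

Lemma tnth_in_setof (n d : nat) (p : d.-tuple {set 'I_n}) (j : 'I_d) :
  tnth p j \in [set:: p].
Proof. by rewrite inE mem_tnth. Qed.

(** As [f] need not be increasing on a block, [c] is not placed in row [f c]: the block is written
    in increasing order into the rows of its image, which has as many elements. *)
Lemma jellyfish_tableau (n d r : nat) (x0 : 'I_n) (p : d.-tuple {set 'I_n})
    (f : 'I_n -> 'I_(nrows n d r)) :
  p \in OP n d r -> fits r [set:: p] f ->
  exists2 T, T \in jellyfish r p &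
    forall j, [set i | T i j != None] = f @: tnth p j.
Proof.
rewrite inE => /and3P[/tuple_uniqP p_inj parP _] [f_inj f_hit f_star f_uniq].
pose F j := f @: tnth p j.
have cardF j : #|F j| = #|tnth p j|.
  by rewrite card_in_imset //; apply: f_inj; rewrite tnth_in_setof.
pose T : tableau n d r := (\matrix_(i, j) if i \in F j then
  Some (nth x0 (enum (tnth p j)) (index i (enum (F j)))) else None)%R.
have TE i j : (T i j != None) = (i \in F j) by rewrite mxE; case: ifP.
exists T; last by move=> j; apply/setP => i; rewrite inE TE.
have idx_lt i j : i \in F j -> index i (enum (F j)) < size (enum (tnth p j)).
  by move=> iF; rewrite -cardE -cardF cardE index_mem mem_enum.
rewrite inE; apply/and4P; split.
- apply/forallP => i; apply/forallP => j; apply/implyP => lt; rewrite TE.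
  by have [c cB <-] := f_hit _ (tnth_in_setof p j) _ lt; rewrite imset_f.
- apply/forallP => i; apply/implyP => ge; have [c fc] := f_star _ ge.
  (* The only nonempty cell of row [i] is in the column whose block contains [c], the one element
     sent to [i]. *)
  have : c \in cover [set:: p] by rewrite (cover_partition parP) inE.
  case/bigcupP => B; rewrite inE => /tnthP[j ->] cB.
  apply/cards1P; exists j; apply/setP => j'; rewrite !inE TE.
  apply/imsetP/eqP => [[c' c'B e]|->]; last by exists c.
  have cc' : c = c' by apply: f_uniq; rewrite fc.
  apply: p_inj; rewrite -cc' in c'B.
  by apply: (partition_block_eq parP _ _ c'B cB); apply: tnth_in_setof.
- apply/forallP => j; apply/eqP/setP => x; rewrite inE.
  apply/existsP/idP => [[k]|xB].
    rewrite mxE; case: ifP => // kF /eqP[<-].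
    by rewrite -mem_enum mem_nth ?idx_lt.
  have ix : index x (enum (tnth p j)) < size (enum (F j)).
    by rewrite -cardE cardF cardE index_mem mem_enum.
  (* Only a default for [nth]. *)
  have i0 : 'I_(nrows n d r) := f x0.
  have iF : nth i0 (enum (F j)) (index x (enum (tnth p j))) \in F j.
    by rewrite -mem_enum mem_nth.
  exists (nth i0 (enum (F j)) (index x (enum (tnth p j)))).
  by rewrite mxE iF index_uniq ?enum_uniq // nth_index ?mem_enum.
- apply/forallP => j; apply/forallP => i; apply/forallP => k.
  apply/forallP => x; apply/forallP => y; apply/implyP => /and3P[lt].
  rewrite !mxE; case: ifP => // iF /eqP[<-]; case: ifP => // kF /eqP[<-].
  apply: (sorted_ltn_nth (@relpre_ltn_trans n) x0 (sorted_enum_set _)).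
  + exact: idx_lt.
  + exact: idx_lt.
  rewrite ltn_neqAle; apply/andP; split.
    apply: contraTneq lt => /(congr1 (nth i (enum (F j)))).
    by rewrite !nth_index ?mem_enum // => ->; rewrite ltnn.
  rewrite leqNgt; apply/negP => lt'.
  have := sorted_ltn_index (@relpre_ltn_trans _) (sorted_enum_set (F j)).
  move=> /(_ k i); rewrite !mem_enum => /(_ kF iF lt') /= lt''.
  by have := ltn_trans lt lt''; rewrite ltnn.
Qed.

(** Each column lists a prescribed set in increasing order, so its nonempty cells determine its
    entries. The proof is by strong induction on the row. *)
Lemma jellyfish_eq (n d r : nat) (p : d.-tuple {set 'I_n})
    (T T' : tableau n d r) :
  T \in jellyfish r p -> T' \in jellyfish r p ->
  (forall i j, (T i j != None) = (T' i j != None)) -> T = T'.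
Proof.
rewrite !inE => /and4P[_ _ /forallP entT /forallP incT].
case/and4P => _ _ /forallP entT' /forallP incT' same.
have inc (U : tableau n d r) :
    (forall j, [forall i : 'I_(nrows n d r), forall k : 'I_(nrows n d r),
      forall x : 'I_n, forall y : 'I_n,
      [&& (i < k)%N, U i j == Some x & U k j == Some y] ==> (x < y)%N]) ->
    forall (i k : 'I_(nrows n d r)) j x y,
      i < k -> U i j = Some x -> U k j = Some y -> x < y.
  move=> H i k j x y lt e e'.
  have /forallP/(_ i)/forallP/(_ k)/forallP/(_ x)/forallP/(_ y) := H j.
  by rewrite lt e e' !eqxx.
apply/matrixP => i j.
have [m] := ubnP (val i); elim: m i => // m IH i ltm.
case eT : (T i j) => [x|]; last first.
  by have := same i j; rewrite eT eqxx; case: (T' i j).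
case eT' : (T' i j) => [y|]; last first.
  by have := same i j; rewrite eT eT' eqxx.
have memT (U : tableau n d r) z k : U k j = Some z ->
    [set x | [exists i, U i j == Some x]] = tnth p j -> z \in tnth p j.
  by move=> e <-; rewrite inE; apply/existsP; exists k; rewrite e.
have xB := memT T x i eT (eqP (entT j)).
have yB := memT T' y i eT' (eqP (entT' j)).
(* [x] occurs in column [j] of [T'], in row [k], and [y] in that of [T], in row [l]. If [x < y], the
   position of [k] relative to [i] contradicts monotonicity or gives [x = y]; if [y < x], that of
   [l] does. *)
move: xB yB; rewrite -{1}(eqP (entT' j)) -(eqP (entT j)) !inE.
move=> /existsP[k /eqP ek] /existsP[l /eqP el].
case: (ltngtP x y) => [lt|lt|/val_inj->//].
- case: (ltngtP k i) => [ki|ik|/val_inj ki].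
  + have eTk : T k j = Some x by rewrite IH // (leq_trans ki).
    by have := inc T incT _ _ _ _ _ ki eTk eT; rewrite ltnn.
  + by have := inc T' incT' _ _ _ _ _ ik eT' ek; lia.
  + by move: ek; rewrite ki eT' => -[->].
- case: (ltngtP l i) => [li|il|/val_inj li].
  + have eTl : T' l j = Some y by rewrite -IH // (leq_trans li).
    by have := inc T' incT' _ _ _ _ _ li eTl eT'; rewrite ltnn.
  + by have := inc T incT _ _ _ _ _ il eT el; lia.
  + by move: el; rewrite li eT => -[->].
Qed.

(** * Values of minors and of jellyfish invariants at 0/1 matrices *)

Definition inc_mx (K : comNzRingType) (n : nat) (g : 'I_n -> 'I_n) : 'M[K]_n :=
  (\matrix_(i, c) (g c == i)%:R)%R.

(** A row of [I] outside [g @: J] would be zero in the submatrix. Thus [I] is contained in [g @: J],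
    which has at most [#|J| = #|I|] elements. *)
Lemma set_minor_inc_image (K : comNzRingType) (n : nat) (g : 'I_n -> 'I_n)
    (I J : {set 'I_n}) :
  set_minor (inc_mx K g) I J != 0%R -> I = g @: J.
Proof.
rewrite /set_minor; case: (#|I| =P #|J|) => [e|_]; last by rewrite eqxx.
move=> det_neq0; apply/eqP; rewrite eqEcard e leq_imset_card andbT.
apply/subsetP => i iI; apply: contraNT det_neq0 => niJ; apply/eqP.
rewrite (expand_det_row _ (enum_rank_in iI i)) big1 // => b _.
rewrite !mxE enum_rankK_in //; case: eqP => [gb|_]; last by rewrite mul0r.
by rewrite -gb imset_f ?enum_valP in niJ.
Qed.

(** The submatrix is the transpose of a permutation matrix: [h] takes the position of a column in
    [J] to the position of its image in [g @: J]. *)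
Lemma set_minor_inc_neq0 (K : comNzRingType) (n : nat) (g : 'I_n -> 'I_n)
    (J : {set 'I_n}) :
  {in J &, injective g} -> set_minor (inc_mx K g) (g @: J) J != 0%R.
Proof.
move=> g_inj; rewrite /set_minor.
case: (#|g @: J| =P #|J|) => [e|]; last by rewrite card_in_imset.
pose ev b := enum_val (cast_ord e b).
have evJ b : ev b \in J by apply: enum_valP.
pose h b := enum_rank_in (imset_f g (evJ b)) (g (ev b)).
have hK b : enum_val (h b) = g (ev b) by rewrite enum_rankK_in ?imset_f.
have h_inj : injective h.
  move=> b b' /(congr1 enum_val); rewrite !hK => /g_inj.
  by move=> /(_ (evJ b) (evJ b')) /enum_val_inj /cast_ord_inj.
rewrite (_ : (\matrix_(a, b) _)%R = (perm_mx (perm h_inj))^T%R).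
  by rewrite det_tr det_perm signr_eq0.
apply/matrixP => a b.
by rewrite !mxE permE -(inj_eq (@enum_val_inj _ _)) hK.
Qed.

(** The point [mxvec M 0], the single row of [mxvec M], substitutes [M i j] for the variable of
    index [mxvec_index i j]. *)
Lemma meval_set_minor (K : comNzRingType) (n : nat) (M : 'M[K]_n)
    (I J : {set 'I_n}) :
  meval (mxvec M 0%R) (set_minor (indet_mx K n) I J) = set_minor M I J.
Proof.
rewrite /set_minor; case: (#|I| =P #|J|) => [e|_]; last by rewrite meval0.
rewrite -det_map_mx; congr (\det _)%R; apply/matrixP => a b.
by rewrite !mxE /= mevalXU mxvecE.
Qed.

Lemma meval_jelly_inv (K : comNzRingType) (n d r : nat)
    (p : d.-tuple {set 'I_n}) (M : 'M[K]_n) :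
  meval (mxvec M 0%R) (jelly_inv K r p) =
  (\sum_(T in jellyfish r p)
     (-1) ^+ Defs.inv T *
     \prod_(j < d) set_minor M (col_rows T j) (tnth p j))%R.
Proof.
rewrite /jelly_inv rmorph_sum; apply: eq_bigr => T _.
rewrite rmorphM rmorphXn rmorphN1 rmorph_prod; congr (_ * _)%R.
by apply: eq_bigr => j _; apply: meval_set_minor.
Qed.

Lemma widen_nrows_inj (n d r : nat) :
  injective (widen_ord (leq_subr (d.-1 * r) n) : 'I_(nrows n d r) -> 'I_n).
Proof. by move=> i k /(congr1 val) e; apply: val_inj. Qed.

Definition filling_mx (K : comNzRingType) (n d r : nat)
    (f : 'I_n -> 'I_(nrows n d r)) : 'M[K]_n :=
  inc_mx K (fun c => widen_ord (leq_subr (d.-1 * r) n) (f c)).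

Lemma set_minor_filling (K : comNzRingType) (n d r : nat)
    (f : 'I_n -> 'I_(nrows n d r)) (T : tableau n d r) (j : 'I_d)
    (J : {set 'I_n}) :
  set_minor (filling_mx K f) (col_rows T j) J != 0%R ->
  [set i | T i j != None] = f @: J.
Proof.
move=> /set_minor_inc_image; rewrite /col_rows (imset_comp _ f).
exact/imset_inj/widen_nrows_inj.
Qed.

(** Some tableau has all its minors nonzero. Its nonempty cells in column [j] are then the image
    under [f] of block [j], and they include the first [r] rows. *)
Lemma jelly_inv_hit (K : fieldType) (n d r : nat) (p : d.-tuple {set 'I_n})
    (f : 'I_n -> 'I_(nrows n d r)) :
  meval (mxvec (filling_mx K f) 0%R) (jelly_inv K r p) != 0%R ->
  forall (B : {set 'I_n}) (i : 'I_(nrows n d r)), B \in p -> i < r ->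
  exists2 c, c \in B & f c = i.
Proof.
rewrite meval_jelly_inv => neq0 B i /tnthP[j ->] lt.
have [T] : exists T, (T \in jellyfish r p) &&
    (\prod_(j < d) set_minor (filling_mx K f) (col_rows T j) (tnth p j) != 0)%R.
  apply/existsP; apply: contraNT neq0 => /existsPn none.
  apply/eqP; rewrite big1 // => T JT; have := none T.
  by rewrite JT /= negbK => /eqP->; rewrite mulr0.
rewrite inE => /andP[/and4P[/forallP/(_ i)/forallP/(_ j)] /implyP/(_ lt) Tij].
move=> _ _ _ /prodf_neq0 /(_ j isT) /set_minor_filling /setP /(_ i).
by rewrite inE Tij => /esym/imsetP[c cB ->]; exists c.
Qed.

(** A nonzero term forces the nonempty cells of each column, hence the tableau. The sum thus reduces
    to the term of [T0], and no cancellation can occur. *)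
Lemma jelly_inv_fits (K : fieldType) (n d r : nat) (x0 : 'I_n)
    (p : d.-tuple {set 'I_n}) (f : 'I_n -> 'I_(nrows n d r)) :
  p \in OP n d r -> fits r [set:: p] f ->
  meval (mxvec (filling_mx K f) 0%R) (jelly_inv K r p) != 0%R.
Proof.
move=> pOP fitf; have [T0 JT0 T0E] := jellyfish_tableau x0 pOP fitf.
rewrite meval_jelly_inv (bigD1 T0) //= [X in (_ + X)%R]big1 => [|T].
  rewrite addr0 mulf_neq0 ?signr_eq0 //; apply/prodf_neq0 => j _.
  rewrite /col_rows T0E -(imset_comp _ f); apply: set_minor_inc_neq0.
  case: fitf => f_inj _ _ _ c c' cB c'B /widen_nrows_inj.
  by apply: f_inj cB c'B; rewrite tnth_in_setof.
case/andP=> JT neqT; apply/eqP; apply: contraNT neqT => term_neq0; apply/eqP.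
apply: jellyfish_eq JT JT0 _ => i j.
have /prodf_neq0/(_ j isT)/set_minor_filling/setP/(_ i) :
    (\prod_(j < d) set_minor (filling_mx K f) (col_rows T j) (tnth p j) != 0)%R.
  by apply: contraNneq term_neq0 => ->; rewrite mulr0.
by rewrite -T0E !inE.
Qed.

(** * Linear independence by triangularity *)

Lemma jelly_inv_lin_indep (K : fieldType) (n d r : nat)
    (ordering : {set {set 'I_n}} -> d.-tuple {set 'I_n}) :
  0 < n -> 0 < d -> 1 < r ->
  (forall gamma : {set {set 'I_n}}, gamma \in NC n d r ->
     ordering gamma \in OP n d r /\ [set:: ordering gamma] = gamma) ->
  lin_indep (NC n d r) (fun gamma => jelly_inv K r (ordering gamma)).
Proof.
move=> n_gt0 d_gt0 r_gt1 orderingP c sum0 g0 g0NC; apply/eqP/negPn/negP => cg0.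
pose x0 : 'I_n := Ordinal n_gt0.
pose Z (g : {set {set 'I_n}}) := (g \in NC n d r) && (c g != 0%R).
have Zg0 : Z g0 by rewrite /Z g0NC.
(* Evaluating the relation at the matrix adapted to a [P] of maximal spread among the partitions
   with nonzero coefficient kills every other term. *)
case: (arg_maxnP (spread x0) Zg0) => P /andP[PNC cP] maxP.
have [f [fitf f0 f1]] := adapted_filling x0 d_gt0 r_gt1 PNC.
have [ordP setP'] := orderingP _ PNC.
have := congr1 (meval (mxvec (filling_mx K f) 0%R)) sum0.
rewrite meval0 rmorph_sum (bigD1 P) //= [X in (_ + X)%R]big1 => [|Q].
  rewrite addr0 mevalZ => /eqP; rewrite mulf_eq0 (negbTE cP) /=.
  by apply/negP; apply: jelly_inv_fits; rewrite ?setP'.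
case/andP=> QNC neqQP; rewrite mevalZ; apply/eqP; rewrite mulf_eq0.
case: (eqVneq (c Q) 0%R) => //= cQ; apply: contraNT neqQP => /jelly_inv_hit hit.
have [_ setQ] := orderingP _ QNC.
have blockQ B : B \in Q -> B \in ordering Q by rewrite -{1}setQ inE.
(* Rows 0 and 1 exist: [d] blocks of size at least [r] give [d * r <= n], so there are at least [r]
   rows. *)
have rows_gt1 : 1 < nrows n d r.
  move: PNC; rewrite inE => /and4P[parP /eqP cardP /forall_inP big _].
  have : d * r <= n.
    rewrite -[n]card_ord -cardsT (card_partition parP) -cardP -sum_nat_const.
    exact: leq_sum.
  by rewrite /nrows -[in d * r](prednK d_gt0) mulSn; lia.
move: (PNC) (QNC); rewrite !inE => /and4P[parP /eqP cardP _ ncP].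
case/and4P=> parQ /eqP cardQ _ ncQ; apply/eqP.
apply: (spread_min parP parQ ncP ncQ _ _ _ (maxP Q _)).
- by rewrite cardP.
- move=> B /blockQ BQ.
  have [x xB fx] := hit B (Ordinal rows_gt1) BQ r_gt1.
  by exists x; rewrite ?f1 ?fx.
- move=> B /blockQ BQ.
  have [x xB fx] := hit B (Ordinal (ltnW rows_gt1)) BQ (ltnW r_gt1).
  by exists x; rewrite ?f0 ?fx.
- by rewrite /Z QNC.
Qed.

(** [R[i]] is the field of complex numbers, built on a model [R] of the reals. *)
Theorem theorem5p9 (R : realType) (n d r : nat)
    (n_gt0 : (0 < n)%N) (d_gt0 : (0 < d)%N) (r_gt1 : (1 < r)%N)
    (ordering : {set {set 'I_n}} -> d.-tuple {set 'I_n})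
    (orderingP : forall gamma : {set {set 'I_n}}, gamma \in NC n d r ->
       ordering gamma \in OP n d r /\ [set:: ordering gamma] = gamma) :
  @lin_indep R[i]%C {mpoly R[i]%C[n * n]} {set {set 'I_n}} (NC n d r)
    (fun gamma => jelly_inv R[i]%C r (ordering gamma)).
Proof. exact: jelly_inv_lin_indep. Qed.
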